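(* In the three-player-game started with no win-lose relationship having occurred and Players $1$ and $2$ in the ring, the expected number of rounds until all six win-lose relationships have appeared is $12.4$; that is, $$f(000000|\{1,2\})=12.4.$$
   Context: The three-player-game (3PG): there are three players $1,2,3$. In each round two distinct players are in the ring and exactly one of them wins; each of the two wins with probability $\frac12$, independently of all other rounds. At the end of a round the loser leaves the ring, the winner stays, and the third player enters the ring for the next round. The game terminates as soon as all six win-lose relationships ''Player $i$ beats Player $j$'' ($i\neq j$ in $\{1,2,3\}$) have occurred at least once. A state is written $(b_1b_2b_3b_4b_5b_6|\{t_1,t_2\})$, where $\{t_1,t_2\}\subset\{1,2,3\}$ is the pair of players currently in the ring, and each bit $b_i\in\{0,1\}$ equals $1$ if the corresponding relationship has already occurred and $0$ otherwise, in the order: $b_1$: 1 beats 2; $b_2$: 2 beats 1; $b_3$: 1 beats 3; $b_4$: 3 beats 1; $b_5$: 2 beats 3; $b_6$: 3 beats 2. When Player $i$ beats Player $j$ in a round, the bit for ''$i$ beats $j$'' is set to $1$ (the other bits are unchanged) and the new ring pair is $\{i,k\}$, where $k$ is the third player. For a state $S$, $f(S)$ denotes the expected number of rounds played, starting from $S$, until all six bits equal $1$ (so $f(111111|\{t_1,t_2\})=0$). *)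

(* Defs.v *)
From HB Require Import structures.
From mathcomp Require Import all_boot all_order all_algebra.
From mathcomp Require Import finmap.
From mathcomp Require Import all_classical all_reals all_analysis.

Set Implicit Arguments.
Unset Strict Implicit.
Unset Printing Implicit Defensive.

Import Order.TTheory GRing.Theory Num.Theory.
Local Open Scope classical_set_scope.
Local Open Scope ring_scope.
Local Open Scope ereal_scope.

Definition player := 'I_3.
Definition player1 : player := @Ordinal 3 0 isT.
Definition player2 : player := @Ordinal 3 1 isT.
Definition player3 : player := @Ordinal 3 2 isT.

(* [(i, j)] stands for "Player i beats Player j"; the order is that of the
   bits b_1 ... b_6 of a state. *)
Definition relationships : 6.-tuple (player * player) :=
  [tuple (player1, player2); (player2, player1);
         (player1, player3); (player3, player1);
         (player2, player3); (player3, player2)].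

(* Only states whose ring has exactly two elements are meaningful; [play]
   preserves this property. *)
Record state := State { bits : 6.-tuple bool ; ring : {set player} }.

Definition play_outcome (S : state) (i j : player) : state :=
  State [tuple tnth (bits S) m || (tnth relationships m == (i, j)) | m < 6]
        (i |: ~: ring S).

(* [enum] lists the ring in increasing order, so the outcome [true] of a round
   means that the lower-numbered of the two players in the ring wins. *)
Definition play (S : state) (c : bool) : state :=
  let lower := nth player1 (enum (ring S)) 0 in
  let higher := nth player1 (enum (ring S)) 1 in
  if c then play_outcome S lower higher else play_outcome S higher lower.

Fixpoint state_after (S : state) (c : nat -> bool) (n : nat) : state :=
  if n is n'.+1 then play (state_after S c n') (c n') else S.

(* Number of rounds until all six bits are 1; it is [+oo] (the infimum of the
   empty set) if this never happens. *)
Definition rounds {R : realType} (S : state) (c : nat -> bool) : \bar R :=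
  ereal_inf [set n%:R%:E | n in [set n | all id (bits (state_after S c n))]].

Definition mutually_independent {d d'} {T : measurableType d}
    {T' : measurableType d'} {R : realType} (P : probability T R)
    (X : nat -> {RV P >-> T'}) : Prop :=
  forall (J : {fset nat}) (B : nat -> set T'),
    (forall n, measurable (B n)) ->
    P (\bigcap_(n in [set` J]) (X n @^-1` B n)) =
    \prod_(n <- J) P (X n @^-1` B n).

Definition independent_fair_rounds {d} {T : measurableType d} {R : realType}
    (P : probability T R) (X : nat -> {RV P >-> bool}) : Prop :=
  mutually_independent X /\
  forall n (b : bool), P (X n @^-1` [set b]) = (2^-1)%:E.

(* The library's ['E_P[_]] only applies to real-valued functions, whereas
   [rounds] may be infinite (on a null set), hence the integral. *)
Definition expected_rounds {d} {T : measurableType d} {R : realType}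
    (P : probability T R) (X : nat -> {RV P >-> bool}) (S : state) : \bar R :=
  \int[P]_w rounds S (fun n => X n w).

(* Main.v *)
Require Import Defs.
From HB Require Import structures.
From mathcomp Require Import all_boot all_order all_algebra.
From mathcomp Require Import finmap.
From mathcomp Require Import all_classical all_reals all_analysis.
From mathcomp Require Import measurable_realfun ring lra.

(* The number of rounds is the sum over n of the indicators that the game is
   still running after n rounds, so its mean is the sum of the corresponding
   probabilities u_n. Conditioning on the first round gives a recursion for u_n
   in the initial state. Let f >= 0 be a bounded function on states, 0 on
   terminal ones, that solves the first-step equations. The same recursion shows
   that f minus the n-th partial sum of the u_k lies between 0 and C u_n. Hence
   the series converges, so that u_n tends to 0 and the sum of the series is f.
   For the three-player game such an f is given by an explicit table. *)

Import Order.TTheory GRing.Theory Num.Theory.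
Import numFieldNormedType.Exports.
Local Open Scope classical_set_scope.
Local Open Scope ring_scope.

(** As [p] stays true once true, the terms are 1 exactly before the first hit, and the series counts
    them. Without a hit, both sides are [+oo]. *)
Lemma ereal_inf_first_hit (R : realType) (p : pred nat) :
  (forall n, p n -> p n.+1) ->
  ereal_inf [set n%:R%:E | n in [set n | p n]] =
  (\sum_(0 <= n <oo) (~~ p n)%:R%:E)%E :> \bar R.
Proof.
move=> pS.
have ge0 n : (0 <= (~~ p n)%:R%:E :> \bar R)%E by rewrite lee_fin.
have sum_before N : (forall k, (k < N)%N -> ~~ p k) ->
    (\sum_(0 <= n < N) (~~ p n)%:R%:E = N%:R%:E :> \bar R)%E.
  move=> ltN; rewrite sumEFin; congr (_%:E).
  rewrite big_mkord (eq_bigr (fun=> 1)) ?sumr_const ?card_ord // => i _.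
  by rewrite ltN.
have [[N0 pN0]|nop] := pselect (exists n, p n).
  have [N pN minN] := ex_minnP (ex_intro _ N0 pN0).
  have p_ge n : (N <= n)%N -> p n.
    by move=> /subnKC <-; elim: (n - N)%N => [|k IH]; rewrite ?addn0 ?addnS ?pS.
  rewrite (nneseries_split 0 N) // add0n sum_before; last first.
    by move=> k; apply: contraTN => /minN; rewrite leqNgt.
  rewrite eseries0 ?adde0 => [|k Nk _]; last by rewrite p_ge.
  apply/eqP; rewrite eq_le; apply/andP; split.
    by apply: ge_ereal_inf; exists N%:R%:E => //; exists N.
  by apply/ereal_infP => _ [n pn <-]; rewrite lee_fin ler_nat minN.
have nop' k : ~~ p k by apply/negP => pk; apply: nop; exists k.
rewrite (_ : [set n | p n] = set0) ?image_set0 ?ereal_inf0; last first.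
  by rewrite -subset0 => n pn; apply: nop; exists n.
apply/esym/eqyP => r r0.
(* Without a hit, the partial sum of this length equals its length, which exceeds [r]. *)
apply: (@le_trans _ _ (Num.Def.truncn r).+1%:R%:E).
  by rewrite lee_fin ltW // truncnS_gt.
by rewrite -sum_before //; apply: nneseries_lim_ge.
Qed.

(** * Survival probabilities and a potential function *)

Section CoinDrivenProcess.
Variables (R : realType) (A : Type) (step : A -> bool -> A) (stop : pred A).
Hypothesis stop_step : forall x c, stop x -> stop (step x c).

(* Probability that the process started at [x] is not stopped after [n] fair
   coin tosses, computed by conditioning on the first toss. *)
Fixpoint survival (n : nat) (x : A) : R :=
  if n is m.+1 then (survival m (step x true) + survival m (step x false)) / 2
  else (~~ stop x)%:R.

Lemma survival_ge0 n x : 0 <= survival n x.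
Proof.
elim: n x => [|n IH] x /=; first exact: ler0n.
by rewrite divr_ge0 // addr_ge0.
Qed.

Section Potential.
Variables (f : A -> R) (C : R).
Hypothesis f_ge0 : forall x, 0 <= f x.
Hypothesis f_leC : forall x, f x <= C.
Hypothesis f_stop : forall x, stop x -> f x = 0.
Hypothesis f_step : forall x, ~~ stop x ->
  f x = 1 + (f (step x true) + f (step x false)) / 2.

(* The middle term is the mean of [f] over the states reached after [n] tosses. *)
Lemma survival_remainder n x :
  0 <= f x - \sum_(0 <= k < n) survival k x <= C * survival n x.
Proof.
elim: n x => [|n IH] x.
  rewrite big_nil subr0 f_ge0 /=; have [/f_stop->|_] := boolP (stop x).
    by rewrite mulr0.
  by rewrite mulr1.
(* The remainder is averaged over the first toss: the 1 in the first-step equation cancels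
   [survival 0 x] in a running state, and both are absent in a stopped one. *)
have -> : f x - \sum_(0 <= k < n.+1) survival k x =
    ((f (step x true) - \sum_(0 <= k < n) survival k (step x true)) +
     (f (step x false) - \sum_(0 <= k < n) survival k (step x false))) / 2.
  rewrite big_nat_recl //= -mulr_suml big_split /=.
  have [sx|sx] := boolP (stop x).
    by rewrite !f_stop ?stop_step //=; field.
  by rewrite (f_step _ sx) /=; field.
have /andP[ht1 ht2] := IH (step x true); have /andP[hf1 hf2] := IH (step x false).
apply/andP; split; first by rewrite divr_ge0 // addr_ge0.
by rewrite /= mulrA ler_pM2r ?invr_gt0 // mulrDr lerD.
Qed.

Lemma survival_series_cvg x : series (survival^~ x) @ \oo --> f x.
Proof.
(* Monotone partial sums bounded by [f x] converge; the limit is not yet identified, but the terms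
   must tend to 0, which makes the squeeze below work. *)
have cvS : cvgn (series (survival^~ x)).
  apply: nondecreasing_is_cvgn.
    by apply: nondecreasing_series => n _ _; exact: survival_ge0.
  exists (f x) => _ [n _ <-].
  by have /andP[] := survival_remainder n x; rewrite subr_ge0.
have cv0 := cvg_series_cvg_0 cvS.
have lo : f x - C * survival n x @[n --> \oo] --> f x.
  rewrite -[X in _ --> X]subr0 -(mulr0 C).
  by apply: cvgB; [exact: cvg_cst|apply: cvgM => //; exact: cvg_cst].
apply: (@squeeze_cvgr _ _ _ _ (fun n => f x - C * survival n x) (fun=> f x)) => //.
  apply: nearW => n; have /andP[] := survival_remainder n x.
  by rewrite subr_ge0 lerBlDr lerBlDl addrC => -> ->.
exact: cvg_cst.
Qed.

End Potential.

(** * Events determined by finitely many tosses *)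

Section Cylinders.
Variables (d : measure_display) (T : measurableType d) (P : probability T R).
Variables (X : nat -> {RV P >-> bool}).
Hypothesis hX : independent_fair_rounds X.

Definition cylinder (s : seq bool) : set T :=
  [set w | mkseq (fun i => X i w) (size s) = s].

(** An intersection over a finite index set is the form to which [mutually_independent] applies. The
    default [false] is never read, since the indices are below [size s]. *)
Lemma cylinderE s :
  cylinder s =
  \bigcap_(i in [set` [fset k in iota 0 (size s)]%fset])
    X i @^-1` [set nth false s i].
Proof.
apply/seteqP; split => w /=.
  move=> ws i /=; rewrite !inE mem_iota add0n => /= ltis.
  by rewrite -[in RHS]ws nth_mkseq.
move=> ws; apply: (@eq_from_nth _ false); rewrite size_mkseq // => i ltis.
by rewrite nth_mkseq //; apply: ws; rewrite /= !inE mem_iota.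
Qed.

Lemma measurable_cylinder s : measurable (cylinder s).
Proof.
rewrite cylinderE; apply: fin_bigcap_measurable => // i _.
exact: measurable_funPTI.
Qed.

Lemma probability_cylinder s : P (cylinder s) = (2^-1 ^+ size s)%:E.
Proof.
case: hX => indep fair; rewrite cylinderE indep //.
under eq_bigr do rewrite fair.
rewrite prodEFin; congr (_%:E).
rewrite big_const_seq count_predT iter_mulr mulr1; congr (_ ^+ _).
rewrite -[LHS]/(#|` [fset k in iota 0 (size s)]|)%fset card_fseq undup_id ?iota_uniq //.
by rewrite size_iota.
Qed.

Let alive (x : A) n : set T :=
  [set w | ~~ stop (foldl step x (mkseq (fun i => X i w) n))].

Lemma cylinder_rcons s b w :
  cylinder (rcons s b) w <-> cylinder s w /\ X (size s) w = b.
Proof.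
rewrite /cylinder /= size_rcons mkseqS; split=> [/rcons_inj[]|[-> ->]] //.
Qed.

(** Fixing an arbitrary prefix [s] avoids shifting the sequence [X]. For [m = 0] the prefix
    determines the state, so the event is empty or the whole cylinder; otherwise it splits along the
    next toss, as in the recursion of [survival]. *)
Lemma probability_cylinder_alive m s x :
  measurable (cylinder s `&` alive x (size s + m)) /\
  P (cylinder s `&` alive x (size s + m)) =
  (2^-1 ^+ size s * survival m (foldl step x s))%:E.
Proof.
elim: m s => [|m IH] s /=.
  rewrite addn0; have [st|nst] := boolP (stop (foldl step x s)).
    rewrite (_ : _ `&` _ = set0) ?measure0 ?mulr0; first by split.
    by rewrite -subset0 => w [/= ws]; rewrite /alive /= ws st.
  rewrite (_ : _ `&` _ = cylinder s) ?mulr1 ?probability_cylinder.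
    by split => //; exact: measurable_cylinder.
  by apply/seteqP; split=> [w []//|w ws]; split => //; rewrite /alive /= ws.
have [mt Pt] := IH (rcons s true); have [mf Pf] := IH (rcons s false).
rewrite !size_rcons !addSnnS in mt Pt mf Pf.
have -> : cylinder s `&` alive x (size s + m.+1) =
   (cylinder (rcons s true) `&` alive x (size s + m.+1)) `|`
   (cylinder (rcons s false) `&` alive x (size s + m.+1)).
  apply/seteqP; split=> [w [ws aw]|w [[/cylinder_rcons[ws _] aw]|[/cylinder_rcons[ws _] aw]]] //.
  by case E : (X (size s) w); [left|right]; split => //; apply/cylinder_rcons.
split; first exact: measurableU.
rewrite measureU //; last first.
  rewrite -subset0 => w [[/cylinder_rcons[_ e1] _] [/cylinder_rcons[_ e2] _]].
  by rewrite e1 in e2.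
rewrite [X in (X + _)%E]Pt [X in (_ + X)%E]Pf !foldl_rcons -EFinD; congr (_%:E).
by rewrite !exprS; field.
Qed.

Lemma probability_alive n x :
  measurable (alive x n) /\ P (alive x n) = (survival n x)%:E.
Proof.
have := probability_cylinder_alive n [::] x.
by rewrite (_ : cylinder [::] = setT) ?setTI ?mul1r //; apply/seteqP; split.
Qed.

(** The terms are nonnegative and measurable, so integral and series may be interchanged; what
    remains is the series of survival probabilities. *)
Lemma expected_stopping_time (f : A -> R) (C : R) (x : A) :
  (forall y, 0 <= f y <= C) ->
  (forall y, stop y -> f y = 0) ->
  (forall y, ~~ stop y -> f y = 1 + (f (step y true) + f (step y false)) / 2) ->
  (\int[P]_w \sum_(0 <= n <oo)
     (~~ stop (foldl step x (mkseq (fun i => X i w) n)))%:R%:E = (f x)%:E)%E.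
Proof.
move=> fC fstop fstep.
have indicE n w : (~~ stop (foldl step x (mkseq (fun i => X i w) n)))%:R
    = \1_(alive x n) w :> R.
  by rewrite indicE; congr ((_ : bool)%:R); apply/idP/idP; rewrite inE.
have intE n : (\int[P]_w (\1_(alive x n) w)%:E = (survival n x)%:E)%E.
  by have [mA PA] := probability_alive n x; rewrite integral_indic // setIT; exact: PA.
under eq_integral do under eq_eseriesr do rewrite indicE.
rewrite integral_nneseries //; last first.
  move=> n; apply/measurable_EFinP; apply: measurable_indic.
  exact: (probability_alive n x).1.
under eq_eseriesr do rewrite intE.
have cvS := @survival_series_cvg f C (fun y => proj1 (andP (fC y)))
  (fun y => proj2 (andP (fC y))) fstop fstep x.
under eq_fun do rewrite sumEFin.
by apply/cvg_lim => //; apply: cvg_EFin => //; exact: nearW.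
Qed.

End Cylinders.
End CoinDrivenProcess.

(** * The explicit solution for the three-player game *)

(* The expected remaining number of rounds times 60, from the state with bits
   [b] and Player [o + 1] outside the ring, is entry [o] of the row numbered
   [sum_m b_m 2 ^ (m - 1)]; the values solve the first-step equations. *)
Definition remaining_rounds_table : seq (seq nat) :=
[:: [:: 744; 744; 744]; [:: 698; 684; 721]; [:: 684; 698; 721]; [:: 638; 638; 698];
 [:: 698; 721; 684]; [:: 612; 636; 636]; [:: 612; 662; 652]; [:: 516; 572; 604];
 [:: 684; 721; 698]; [:: 612; 652; 662]; [:: 624; 675; 675]; [:: 552; 606; 639];
 [:: 638; 698; 638]; [:: 516; 604; 572]; [:: 552; 639; 606]; [:: 420; 540; 540];
 [:: 721; 698; 684]; [:: 662; 612; 652]; [:: 636; 612; 636]; [:: 572; 516; 604];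
 [:: 675; 675; 624]; [:: 576; 564; 552]; [:: 564; 576; 552]; [:: 420; 420; 480];
 [:: 652; 662; 612]; [:: 552; 552; 552]; [:: 552; 576; 564]; [:: 432; 456; 504];
 [:: 606; 639; 552]; [:: 456; 504; 432]; [:: 480; 540; 480]; [:: 240; 360; 360];
 [:: 721; 684; 698]; [:: 675; 624; 675]; [:: 652; 612; 662]; [:: 606; 552; 639];
 [:: 662; 652; 612]; [:: 576; 552; 564]; [:: 552; 552; 552]; [:: 456; 432; 504];
 [:: 636; 636; 612]; [:: 564; 552; 576]; [:: 552; 564; 576]; [:: 480; 480; 540];
 [:: 572; 604; 516]; [:: 420; 480; 420]; [:: 432; 504; 456]; [:: 240; 360; 360];
 [:: 698; 638; 638]; [:: 639; 552; 606]; [:: 604; 516; 572]; [:: 540; 420; 540];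
 [:: 639; 606; 552]; [:: 540; 480; 480]; [:: 504; 456; 432]; [:: 360; 240; 360];
 [:: 604; 572; 516]; [:: 504; 432; 456]; [:: 480; 420; 420]; [:: 360; 240; 360];
 [:: 540; 540; 420]; [:: 360; 360; 240]; [:: 360; 360; 240]; [:: 0; 0; 0]]%N.

Definition remaining_rounds60 (b : seq bool) (o : nat) : nat :=
  nth 0%N (nth [::] remaining_rounds_table
    (foldr (fun (c : bool) k => c + k.*2)%N 0 b)) o.

Lemma remaining_rounds60_le b o : (remaining_rounds60 b o <= 744)%N.
Proof.
have leT : all (all (leq^~ 744)) remaining_rounds_table by vm_compute.
rewrite /remaining_rounds60; move: remaining_rounds_table leT => t.
set k := foldr _ _ _ => leT.
have [tk|kt] := leqP (size t) k; first by rewrite (nth_default [::]) // nth_nil.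
have := all_nthP [::] leT k kt; set r := nth _ _ _ => leR.
have [ro|oR] := leqP (size r) o; first by rewrite nth_default.
exact: all_nthP 0%N leR o oR.
Qed.

(* The second component is the player outside the ring. *)
Definition position : Type := 6.-tuple bool * player.

(** The image consists exactly of the states whose ring has two players. *)
Definition state_of (x : position) : state := State x.1 [set~ x.2]%SET.

Definition lower_player (o : player) : player :=
  if o == player1 then player2 else player1.
Definition higher_player (o : player) : player :=
  if o == player3 then player2 else player3.

Definition position_play (x : position) (c : bool) : position :=
  let lower := lower_player x.2 in
  let higher := higher_player x.2 in
  let: (i, j) := if c then (lower, higher) else (higher, lower) in
  ([tuple tnth x.1 m || (tnth relationships m == (i, j)) | m < 6], j).

Definition position_over (x : position) : bool := all id x.1.

Lemma playerP (o : player) : [\/ o = player1, o = player2 | o = player3].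
Proof.
by case: o => [[|[|[|//]]] lt3]; [constructor 1|constructor 2|constructor 3];
  apply: val_inj.
Qed.

Lemma enum_ring (o : player) :
  enum [set~ o]%SET = [:: lower_player o; higher_player o].
Proof.
apply: (inj_map val_inj); rewrite /enum_mem -enumT !enum_ordSl.
rewrite (size0nil (size_enum_ord 0)) /= !inE.
by case: (playerP o) => ->.
Qed.

(** The new ring holds the winner and the player who was outside, so its complement is the loser. *)
Lemma play_state_of x c : play (state_of x) c = state_of (position_play x c).
Proof.
case: x => b o; rewrite /play /state_of /= enum_ring /=.
by case: c; rewrite /play_outcome /position_play /=; congr State;
  apply/setP => k; rewrite !inE; case: (playerP o) => ->; case: (playerP k) => ->.
Qed.

Lemma state_after_state_of x c n :
  state_after (state_of x) c n = state_of (foldl position_play x (mkseq c n)).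
Proof. by elim: n => [//|n IH]; rewrite mkseqS foldl_rcons /= IH play_state_of. Qed.

Lemma position_over_play x c : position_over x -> position_over (position_play x c).
Proof.
move=> /all_tnthP xP; apply/all_tnthP => m /=.
by rewrite /position_play; case: c; rewrite tnth_mktuple xP.
Qed.

(** The right-hand side is a plain list that evaluates once the bits are known, which lets the
    first-step equations be checked by computation. *)
Lemma mark_bits (b : 6.-tuple bool) (p : player * player) :
  [tuple tnth b m || (tnth relationships m == p) | m < 6] =
  [seq y.1 || (y.2 == p) | y <- zip b relationships] :> seq bool.
Proof.
have sz : size (zip b relationships) = 6 by rewrite size_zip !size_tuple.
apply: (@eq_from_nth _ false); rewrite size_tuple ?size_map ?sz // => i lti.
rewrite -[i]/(val (Ordinal lti)) -tnth_nth tnth_mktuple.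
rewrite (nth_map (false, (player1, player1))) ?sz // nth_zip ?size_tuple //=.
by rewrite !(tnth_nth false) !(tnth_nth (player1, player1)).
Qed.

Definition remaining_rounds (R : realType) (x : position) : R :=
  (remaining_rounds60 x.1 x.2)%:R / 60.

Lemma remaining_rounds_over (R : realType) x :
  position_over x -> remaining_rounds R x = 0.
Proof.
case: x => -[[|b1 [|b2 [|b3 [|b4 [|b5 [|b6 [|//]]]]]]] // sz] o.
rewrite /position_over /remaining_rounds /=.
by case: (playerP o) => -> /and5P[-> -> -> -> /and3P[-> -> _]]; rewrite mul0r.
Qed.

(** This is the first-step equation multiplied by 120, hence an identity between naturals, checked
    for each of the 3 outside players and 63 unfinished bit patterns. *)
Lemma remaining_rounds60_first_step x : ~~ position_over x ->
  (2 * remaining_rounds60 x.1 x.2 =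
   120 + (remaining_rounds60 (position_play x true).1 (position_play x true).2 +
          remaining_rounds60 (position_play x false).1 (position_play x false).2))%N.
Proof.
rewrite /position_play /position_over /= !mark_bits.
case: x => -[[|b1 [|b2 [|b3 [|b4 [|b5 [|b6 [|//]]]]]]] // sz] o /=.
by case: (playerP o) => ->; case: b1 b2 b3 b4 b5 b6 {sz} => [] [] [] [] [] [] // _;
   vm_compute.
Qed.

Lemma remaining_rounds_first_step (R : realType) x : ~~ position_over x ->
  remaining_rounds R x = 1 + (remaining_rounds R (position_play x true) +
    remaining_rounds R (position_play x false)) / 2.
Proof.
move=> /remaining_rounds60_first_step /(congr1 (GRing.natmul (1 : R))).
by rewrite natrM !natrD /remaining_rounds => E; lra.
Qed.

Lemma initial_state_of :
  State [tuple false; false; false; false; false; false]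
    [set player1; player2]%SET =
  state_of ([tuple false; false; false; false; false; false], player3).
Proof.
by congr State; apply/setP => k; rewrite !inE; case: (playerP k) => ->.
Qed.

Theorem mainTheorem1 (R : realType) (d : measure_display)
    (T : measurableType d) (P : probability T R)
    (X : nat -> {RV P >-> bool}) (hX : independent_fair_rounds X) :
  expected_rounds X
    (State [tuple false; false; false; false; false; false]
           [set player1; player2]%SET)
  = ((124 / 10 : R)%:E)%E.
Proof.
rewrite initial_state_of; set x0 := (_, player3).
have -> : 124 / 10 = remaining_rounds R x0.
  (* Row 0 of the table gives 744, and 744 / 60 = 12.4. *)
  by rewrite /remaining_rounds /= -[remaining_rounds60 _ _]/744%N; field.
rewrite /expected_rounds /rounds.
under eq_integral => w _.
  under eq_set do rewrite state_after_state_of.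
  rewrite ereal_inf_first_hit; last first.
    by move=> n; rewrite mkseqS foldl_rcons => /position_over_play; apply.
  over.
(* The bound [C] is 744 / 60 because 744 is the largest table entry. *)
apply: (@expected_stopping_time _ _ position_play position_over
  position_over_play _ _ _ _ hX (remaining_rounds R) (744 / 60)).
- move=> y; rewrite divr_ge0 ?ler0n //= ler_pM2r ?invr_gt0 ?ltr0n //.
  by rewrite ler_nat remaining_rounds60_le.
- exact: remaining_rounds_over.
- exact: remaining_rounds_first_step.
Qed.
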